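(* Let $\mathfrak g$ be a $2n$-dimensional unimodular real Lie algebra and let $(J,F)$ be a Hermitian structure on $\mathfrak g$ with associated inner product $g$. Then $(J,F)$ is balanced if and only if there exists a $g$-orthonormal basis $\{e_1,\dots,e_{2n}\}$ of $\mathfrak g$ such that $$\sum_{i=1}^{2n}[Je_i,e_i]=0.$$ In particular, if $J$ is a complex structure on $\mathfrak g$ and $\{e_1,\dots,e_{2n}\}$ is a $J$-adapted basis satisfying $\sum_{i=1}^{2n}[Je_i,e_i]=0$, then $F=\sum_{k=1}^n e^{2k-1}\wedge e^{2k}$ (in terms of the dual basis) is balanced.
   Context: $\mathfrak g$ is unimodular if $\operatorname{tr}\operatorname{ad}_X=0$ for all $X$. A complex structure on $\mathfrak g$ is a linear map $J$ with $J^2=-\mathrm{Id}$ and $[JX,JY]-J[JX,Y]-J[X,JY]-[X,Y]=0$ for all $X,Y$. A Hermitian structure is a pair $(J,g)$ with $J$ a complex structure and $g$ an inner product with $g(JX,JY)=g(X,Y)$; it is equivalently denoted $(J,F)$ with fundamental form $F(X,Y)=g(X,JY)$, so $g(X,Y)=F(JX,Y)$. It is balanced if $d(F^{n-1})=0$ (equivalently $d^*F=0$), $d$ being the Chevalley-Eilenberg differential ($d\alpha(X,Y)=-\alpha([X,Y])$ on $1$-forms). A basis is $J$-adapted if $Je_{2k-1}=-e_{2k}$ for $k=1,\dots,n$. *)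

(* Defs.v *)
From mathcomp Require Import all_boot all_order all_fingroup all_algebra.
From mathcomp Require Import reals.

Set Implicit Arguments.
Unset Strict Implicit.
Unset Printing Implicit Defensive.

Import Order.TTheory GRing.Theory Num.Theory.
Local Open Scope ring_scope.

Section LieAlgebra.
Variables (R : realType) (V : vectType R).
Implicit Types (br : {bilinear V -> V -> V}) (J : 'End(V)).

Definition lie_bracket br : Prop :=
  (forall x, br x x = 0) /\
  (forall x y z, br x (br y z) + br y (br z x) + br z (br x y) = 0).

Definition endo_trace (f : 'End(V)) : R :=
  \tr (passmx.mxof (vbasis {:V}) (vbasis {:V}) f).

Definition ad br (x : V) : 'End(V) := linfun (br x).

Definition unimodular br : Prop := forall x, endo_trace (ad br x) = 0.

Definition complex_structure br J : Prop :=
  (forall x, J (J x) = - x) /\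
  (forall x y,
     br (J x) (J y) - J (br (J x) y) - J (br x (J y)) - br x y = 0).

(* An inner product on V is an element of {dot V for idfun}: a bilinear,
   symmetric, positive definite form. *)
Definition hermitian_structure br J (g : {dot V for idfun}) : Prop :=
  complex_structure br J /\ (forall x y, g (J x) (J y) = g x y).

(* A k-form is represented by its values on k-tuples of vectors. The operations
   below are total on such functions; every form they are applied to in the
   sequel is multilinear and alternating. *)
Definition cochain (k : nat) : Type := {ffun 'I_k -> V} -> R.

Definition wedge k l (a : cochain k) (b : cochain l) : cochain (k + l) :=
  fun v => (k`! * l`!)%:R^-1 *
    \sum_(s : 'S_(k + l)) (-1) ^+ s *
      (a [ffun i => v (s (lshift l i))] * b [ffun j => v (s (rshift k j))]).

Fixpoint wedge_exp k (a : cochain k) (m : nat) : cochain (m * k) :=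
  if m is m'.+1 then wedge a (@wedge_exp k a m') else fun => 1.
Arguments wedge_exp {k} a m.

(* Chevalley-Eilenberg differential (trivial coefficients):
     (d a)(v_0, ..., v_k) = \sum_(i < j) (-1)^(i + j)
       a([v_i, v_j], v_0, ..., omit v_i, ..., omit v_j, ..., v_k).
   For i < j and p < k - 1, bump j (bump i p) is the p-th element of
   {0, ..., k} minus {i, j}. *)
Definition CE_diff br k (a : cochain k) : cochain k.+1 :=
  fun v => \sum_(i < k.+1) \sum_(j < k.+1 | (i < j)%N) (-1) ^+ (i + j) *
    a [ffun m : 'I_k => if m == 0%N :> nat then br (v i) (v j)
                        else v (inord (bump j (bump i m.-1)))].

Definition fundamental_form J (g : {dot V for idfun}) : cochain 2 :=
  fun v => g (v ord0) (J (v ord_max)).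

(* n.-1 is truncated: for n = 0 the exponent is 0, and the condition is trivial. *)
Definition balanced br (n : nat) (F : cochain 2) : Prop :=
  forall v, CE_diff br (wedge_exp F n.-1) v = 0.

Section AdaptedBasis.
Variable n : nat.

Lemma odd_idx_subproof (k : 'I_n) : (k.*2 < n.*2)%N.
Proof. by rewrite ltn_double. Qed.

Lemma even_idx_subproof (k : 'I_n) : (k.*2.+1 < n.*2)%N.
Proof. by rewrite ltn_Sdouble. Qed.

(* Bases are indexed from 0: e_(2k-1) and e_(2k), 1 <= k <= n, are the vectors
   at indices odd_idx (k - 1) and even_idx (k - 1). *)
Definition odd_idx (k : 'I_n) : 'I_(n.*2) := Ordinal (odd_idx_subproof k).
Definition even_idx (k : 'I_n) : 'I_(n.*2) := Ordinal (even_idx_subproof k).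

Variable e : (n.*2).-tuple V.

Definition adapted_basis J : Prop :=
  basis_of {:V} e /\ (forall k : 'I_n, J e`_(odd_idx k) = - e`_(even_idx k)).

Definition dual_covector (i : 'I_(n.*2)) : cochain 1 :=
  fun v => coord e i (v ord0).

Definition adapted_form : cochain 2 :=
  fun v => \sum_(k < n)
    wedge (dual_covector (odd_idx k)) (dual_covector (even_idx k)) v.

End AdaptedBasis.

End LieAlgebra.

(* Main.v *)
From HB Require Import structures.
Require Import Defs.
From mathcomp Require Import all_boot all_order all_fingroup all_algebra.
From mathcomp Require Import boolp functions reals ring zify.
Import Order.TTheory GRing.Theory Num.Theory.
Local Open Scope ring_scope.

Set Implicit Arguments.
Unset Strict Implicit.
Unset Printing Implicit Defensive.

(** Write X for the sum of the [Je_i, e_i] over an orthonormal basis, and w_m for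
    the m-th wedge power of F.  The whole proof is the identity
      2n d(w_(n-1)) = - iota_X w_n,
    which holds on every unimodular Lie algebra of dimension 2n > 0 (for n = 0 both
    conditions are void).  It has two ingredients.

    The first is linear algebra.  Contracting iota_x w_m = m F_x /\ w_(m-1), where
    F_x = F(x, _), a second time and summing over the pairs (Je_i, e_i) gives
      sum_i iota_(e_i) iota_(Je_i) w_m = 2m (n - m + 1) w_(m-1),
    because the numbers F(Je_i, e_i) are 1 and the 2-forms F_(Je_i) /\ F_(e_i) add
    up to 2F (lemma contract_ext2_powJ).  For m = n the factor is 2n.

    The second is the divergence formula for a form b of top degree,
      d(iota_y iota_x b) = iota_([y, x]) b
    (lemma CE_list_iprod2_top).  It is a consequence of Cartan's formula
    iota_x d + d iota_x = L_x, since db = 0 for degree reasons and L_x b = 0 by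
    unimodularity, L_x acting on top forms as minus the trace of ad x.

    So F is balanced if and only if iota_X w_n = 0.  Contracting this equation
    with the first identity again and again lowers n to 1 and leaves iota_X F = 0,
    that is, X = 0 (lemma ext2_pow_nondeg).  As the equivalence is valid for every
    orthonormal basis, only the existence of one remains to be proved.  For the
    second half of the theorem, the inner product is the one in which the given
    adapted basis is orthonormal.

    Forms are handled as functions on lists of vectors.  Each of the operations
    above is then a recursion on the list: the first entry x is removed by means of
    the commutation rule of the operation with iota_x, so that the rules of the
    exterior calculus hold by definition and the algebra involves no permutation.
    Permutations occur only in the comparison with the wedge product of cochains. *)

(** * Exterior calculus on lists of vectors *)

Section Forms.
Variables (R : realType) (V : vectType R).

(** A form of mixed degree; its degree k component is the restriction to lists of
    length k.  The codomain R^o gives such functions their pointwise vector space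
    structure. *)
Definition lform : Type := seq V -> R^o.
HB.instance Definition _ := GRing.Lmodule.on lform.

Implicit Types (b : lform) (a : V -> R) (A : V -> V) (x y : V) (s p q : seq V).

Definition multilinear b := forall p q c x y,
  b (p ++ (c *: x + y) :: q) = c * b (p ++ x :: q) + b (p ++ y :: q).

Definition alternating b := forall p q x, b (p ++ x :: x :: q) = 0.

Definition alt_form b := multilinear b /\ alternating b.

Definition iprod x b : lform := fun s => b (x :: s).

(** Wedge product with the covector a on the left; the recursion is the
    antiderivation rule iota_x (a /\ b) = a x * b - a /\ iota_x b. *)
Definition ext a : lform -> lform := fix ext b s :=
  if s is x :: s' then a x * b s' - ext (iprod x b) s' else 0.

(** Wedge product with the 2-form F; the recursion is the derivation rule
    iota_x (F /\ b) = (iota_x F) /\ b + F /\ iota_x b. *)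
Definition ext2 (F : V -> V -> R) : lform -> lform := fix ext2 b s :=
  if s is x :: s' then ext (F x) b s' + ext2 (iprod x b) s' else 0.

(** The derivation induced by an endomorphism A: the sum of the values of b on the
    lists obtained by applying A to one entry.  The Lie derivative along x is
    minus this operation for A = ad x. *)
Definition endo_act A : lform -> lform := fix endo_act b s :=
  if s is x :: s' then b (A x :: s') + endo_act (iprod x b) s' else 0.

(** The Chevalley-Eilenberg differential, defined by Cartan's formula
    iota_x (d b) = L_x b - d (iota_x b). *)
Definition CE_list (br : V -> V -> V) : lform -> lform := fix CE_list b s :=
  if s is x :: s' then - endo_act (br x) b s' - CE_list (iprod x b) s' else 0.

Lemma lformP c b b' s : (c *: b + b') s = c * b s + b' s.
Proof. by []. Qed.

Lemma lform_addE b b' s : (b + b') s = b s + b' s.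
Proof. by []. Qed.

Lemma lform_oppE b s : (- b) s = - b s.
Proof. by []. Qed.

Lemma lform_scaleE c b s : (c *: b) s = c * b s.
Proof. by []. Qed.

Lemma lform_sumE I (r : seq I) (P : pred I) (f : I -> lform) s :
  (\sum_(i <- r | P i) f i) s = \sum_(i <- r | P i) f i s.
Proof.
by elim/big_rec2: _ => //= i _ c _ <-.
Qed.

Definition lformE := (lform_addE, lform_oppE, lform_scaleE, lform_sumE).

Fact iprod_linear x : linear (iprod x).
Proof. by []. Qed.
HB.instance Definition _ x :=
  GRing.isLinear.Build R lform lform *:%R (iprod x) (iprod_linear x).

Fact ext_linear a : linear (ext a).
Proof.
move=> c b b'; apply/funext => s; rewrite lformP.
elim: s b b' => [|x s IHs] b b' /=; first by rewrite mulr0 addr0.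
rewrite linearP IHs lformP mulrDr mulrBr !mulrA [a x * c]mulrC opprD !addrA.
by congr (_ + _); rewrite addrAC.
Qed.
HB.instance Definition _ a :=
  GRing.isLinear.Build R lform lform *:%R (ext a) (ext_linear a).

Fact ext2_linear F : linear (ext2 F).
Proof.
move=> c b b'; apply/funext => s; rewrite lformP.
elim: s b b' => [|x s IHs] b b' /=; first by rewrite mulr0 addr0.
by rewrite !linearP IHs !lformP mulrDr addrACA.
Qed.
HB.instance Definition _ F :=
  GRing.isLinear.Build R lform lform *:%R (ext2 F) (ext2_linear F).

Fact endo_act_linear A : linear (endo_act A).
Proof.
move=> c b b'; apply/funext => s; rewrite lformP.
elim: s b b' => [|x s IHs] b b' /=; first by rewrite mulr0 addr0.
by rewrite linearP IHs !lformP mulrDr addrACA.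
Qed.
HB.instance Definition _ A :=
  GRing.isLinear.Build R lform lform *:%R (endo_act A) (endo_act_linear A).

Fact CE_list_linear br : linear (CE_list br).
Proof.
move=> c b b'; apply/funext => s; rewrite lformP.
elim: s b b' => [|x s IHs] b b' /=; first by rewrite mulr0 addr0.
rewrite (linearP (iprod x)) (linearP (endo_act (br x))) IHs lformP.
by rewrite !opprD mulrDr !mulrN addrACA.
Qed.
HB.instance Definition _ br :=
  GRing.isLinear.Build R lform lform *:%R (CE_list br) (CE_list_linear br).

Lemma extB a b b' : ext a (b - b') = ext a b - ext a b'.
Proof. exact: linearB. Qed.

Lemma extZ a c b : ext a (c *: b) = c *: ext a b.
Proof. exact: linearZ. Qed.

Lemma ext2B F b b' : ext2 F (b - b') = ext2 F b - ext2 F b'.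
Proof. exact: linearB. Qed.

Lemma ext2Z F c b : ext2 F (c *: b) = c *: ext2 F b.
Proof. exact: linearZ. Qed.

Lemma iprod_ext x a b : iprod x (ext a b) = a x *: b - ext a (iprod x b).
Proof. by []. Qed.

Lemma iprod_ext2 x F b : iprod x (ext2 F b) = ext (F x) b + ext2 F (iprod x b).
Proof. by []. Qed.

Lemma iprod_multilinear x b : multilinear b -> multilinear (iprod x b).
Proof. by move=> bM p; apply: (bM (x :: p)). Qed.

Lemma iprod_alternating x b : alternating b -> alternating (iprod x b).
Proof. by move=> bA p; apply: (bA (x :: p)). Qed.

Lemma multilinear0 b p q : multilinear b -> b (p ++ 0 :: q) = 0.
Proof.
by move=> bM; have := bM p q (-1) 0 0; rewrite scaleN1r addNr mulN1r addNr.
Qed.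

Lemma iprodP c x y b : multilinear b ->
  iprod (c *: x + y) b = c *: iprod x b + iprod y b.
Proof. by move=> bM; apply/funext => s; apply: (bM [::]). Qed.

Lemma iprod_alt_form x b : alt_form b -> alt_form (iprod x b).
Proof.
by case=> bM bA; split; [apply: iprod_multilinear | apply: iprod_alternating].
Qed.

Lemma iprod_iprod x b : alternating b -> iprod x (iprod x b) = 0.
Proof. by move=> bA; apply/funext => s; apply: (bA [::]). Qed.

Lemma extDl c a a' b : ext (fun z => c * a z + a' z) b = c *: ext a b + ext a' b.
Proof.
apply/funext => s; rewrite lformP.
elim: s b => [|x s IHs] b /=; first by rewrite mulr0 addr0.
by rewrite IHs mulrDl mulrBr mulrA opprD addrACA.
Qed.

Lemma ext_alt_form a b : scalar a -> alt_form b -> alt_form (ext a b).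
Proof.
move=> aL [bM bA]; split=> p q.
  move=> c x y; elim: p b bM {bA} => [|z p IHp] b bM /=.
    rewrite iprodP // linearP /= aL lformP; ring.
  rewrite bM IHp; last exact: iprod_multilinear.
  ring.
move=> x; elim: p b bA {bM} => [|z p IHp] b bA /=.
  by rewrite iprod_iprod // linear0 subr0 subrr.
by rewrite bA IHp ?mulr0 ?subr0 //; apply: iprod_alternating.
Qed.

Lemma ext2_alt_form F b :
  (forall c x y z, F (c *: x + y) z = c * F x z + F y z) ->
  (forall x y, F x y = - F y x) ->
  alt_form b -> alt_form (ext2 F b).
Proof.
move=> FL FA.
have FLr x : scalar (F x).
  by move=> c y z; rewrite !(FA x) FL opprD mulrN.
have F0 x : F x x = 0.
  by apply/eqP; rewrite -eqNr -FA.
move=> [bM bA]; split=> p q.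
  move=> c x y; elim: p b bM bA => [|z p IHp] b bM bA /=.
    rewrite iprodP // linearP /= (_ : F _ = fun z => c * F x z + F y z).
      by rewrite extDl !lformP mulrDr addrACA.
    by apply/funext => z.
  have [eM _] := ext_alt_form (FLr z) (conj bM bA).
  rewrite eM IHp; [ring | exact: iprod_multilinear | exact: iprod_alternating].
move=> x; elim: p b bM bA => [|z p IHp] b bM bA /=.
  by rewrite iprod_iprod // linear0 F0 mul0r add0r addr0 addNr.
have [_ eA] := ext_alt_form (FLr z) (conj bM bA).
rewrite eA IHp ?addr0 //; first by apply: iprod_multilinear.
by apply: iprod_alternating.
Qed.

(** Alternation in the first two entries: the two terms in which A meets one of the
    two equal entries cancel, as one sees by polarizing b at A x + x. *)
Lemma endo_act_alt_form A b : linear A -> alt_form b -> alt_form (endo_act A b).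
Proof.
move=> AL [bM bA]; split=> p q.
  move=> c x y; elim: p b bM {bA} => [|z p IHp] b bM /=.
    by rewrite iprodP // linearP /= AL (bM [::]) !lformP mulrDr addrACA.
  rewrite (bM (A z :: p)) IHp; last exact: iprod_multilinear.
  ring.
move=> x; elim: p b bM bA => [|z p IHp] b bM bA /=.
  rewrite iprod_iprod // linear0 addr0 addrC /iprod.
  have := bA [::] q (A x + x); rewrite -[A x]scale1r /=.
  rewrite (bM [::]) !mul1r !(bM [:: _] q 1) !mul1r scale1r.
  by rewrite !(bA [::]) add0r addr0 addrC.
by rewrite (bA (A z :: p)) IHp ?addr0 //;
  [apply: iprod_multilinear | apply: iprod_alternating].
Qed.

Lemma endo_actDl c A A' b : multilinear b ->
  endo_act (fun z => c *: A z + A' z) b = c *: endo_act A b + endo_act A' b.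
Proof.
move=> bM; apply/funext => s; rewrite lformP.
elim: s b bM => [|x s IHs] b bM /=; first by rewrite mulr0 addr0.
rewrite (bM [::]) IHs /=; last exact: iprod_multilinear.
ring.
Qed.

(** Alternation in the first two entries: the two Lie derivatives along x cancel,
    and what is left is a value of b at br x x = 0. *)
Lemma CE_list_alt_form br b :
  (forall z, linear (br z)) -> (forall z, linear (br^~ z)) ->
  (forall x, br x x = 0) -> alt_form b -> alt_form (CE_list br b).
Proof.
move=> brr brl br0 [bM bA].
split=> p q.
  move=> c x y; elim: p b bM bA => [|z p IHp] b bM bA /=.
    rewrite iprodP // linearP /= (_ : br _ = fun z => c *: br x z + br y z).
      by rewrite endo_actDl // !lformP !opprD mulrDr !mulrN addrACA.
    by apply/funext => z; apply: brl.
  have [dM _] := endo_act_alt_form (brr z) (conj bM bA).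
  rewrite dM IHp; [ring | exact: iprod_multilinear | exact: iprod_alternating].
move=> x; elim: p b bM bA => [|z p IHp] b bM bA /=.
  have b0 : b (0 :: q) = 0 := multilinear0 [::] q bM.
  rewrite iprod_iprod // linear0 br0 b0 [X in _ - (_ - X)](_ : _ = 0) //.
  ring.
have [_ dA] := endo_act_alt_form (brr z) (conj bM bA).
rewrite dA IHp ?subr0 ?oppr0 //; first by apply: iprod_multilinear.
by apply: iprod_alternating.
Qed.

End Forms.
Arguments lform {R} V.

(** * Powers of a 2-form and their contractions *)

Section Powers.
Variables (R : realType) (V : vectType R).
Implicit Types (b : lform V) (a : V -> R) (A : V -> V) (x y : V) (s p q : seq V).

Lemma ext_anticomm a a' b : ext a (ext a' b) = - ext a' (ext a b).
Proof.
apply/funext => s; rewrite -[RHS]/(- _ s).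
elim: s b => [|x s IHs] b; first by rewrite oppr0.
rewrite /= !iprod_ext !extB !extZ !lformE IHs; ring.
Qed.

Lemma ext_ext2 a F b : ext a (ext2 F b) = ext2 F (ext a b).
Proof.
apply/funext => s; elim: s b => [|x s IHs] b //=.
rewrite iprod_ext iprod_ext2 linearD ext2B ext2Z ext_anticomm /=.
rewrite !lformE IHs; ring.
Qed.

(** The constant 0-form 1, extended by zero to the positive degrees. *)
Definition unit_form : lform V := fun s => (nilp s)%:R.

Definition ext2_pow F m : lform V := iter m (ext2 F) unit_form.

Lemma iprod_unit_form x : iprod x unit_form = 0.
Proof. by []. Qed.

Lemma unit_form_alt_form : alt_form unit_form.
Proof. by split=> p *; rewrite /unit_form; case: p => //=; rewrite mulr0 addr0. Qed.

(** If F is the sum of the tensors u_i * w_i, then antisymmetrizing gives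
    sum_i u_i /\ w_i = 2F. *)
Lemma sum_ext_ext (I : finType) (u w : I -> V -> R) F b :
  (forall x z, \sum_i u i x * w i z = F x z) ->
  (forall x z, F x z = - F z x) ->
  \sum_i ext (u i) (ext (w i) b) = 2%:R *: ext2 F b.
Proof.
move=> uwF FA; apply/funext => s; rewrite lform_sumE -[RHS]/(_ * _).
have ext_sum x (c : I -> R) (t : I -> V -> R) q d :
  (forall z, \sum_i c i * t i z = F x z) ->
  \sum_i c i * ext (t i) d q = ext (F x) d q.
  move=> cF; elim: q d => [|y q IHq] d /=; first by rewrite big1 // => i; rewrite mulr0.
  rewrite -cF -IHq mulr_suml -sumrB; apply: eq_bigr => i _; ring.
elim: s b => [|x s IHs] b /=; first by rewrite big1 ?mulr0.
have IH : \sum_i _ = _ := IHs (iprod x b).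
under eq_bigr => i _ do
  rewrite iprod_ext extB extZ !lformE opprB addrA.
rewrite big_split big_split /= IH (ext_sum x) //.
under [X in _ + X]eq_bigr => i _ do rewrite -mulNr.
rewrite (ext_sum x (fun i => - w i x)); last first.
  move=> z; rewrite FA -uwF -sumrN; apply: eq_bigr => i _; ring.
ring.
Qed.

Section Pow2.
Variable F : V -> V -> R.
Hypothesis FL : forall c x y z, F (c *: x + y) z = c * F x z + F y z.
Hypothesis FA : forall x y, F x y = - F y x.

Lemma ext2_pow_alt_form m : alt_form (ext2_pow F m).
Proof.
by elim: m => [|m IHm]; [apply: unit_form_alt_form | apply: ext2_alt_form].
Qed.

(** Induction on m: iota_x is a derivation with respect to the 2-form F, and F_x
    commutes with F. *)
Lemma iprod_ext2_pow x m : iprod x (ext2_pow F m) = m%:R *: ext (F x) (ext2_pow F m.-1).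
Proof.
elim: m => [|m IHm]; first by rewrite scale0r iprod_unit_form.
rewrite [ext2_pow F m.+1]/= iprod_ext2 IHm ext2Z -ext_ext2.
case: m {IHm} => [|m] /=; first by rewrite scale0r addr0 scale1r.
by rewrite -[m.+2]addn1 natrD scalerDl scale1r addrC.
Qed.

(** The second contraction either hits the covector F(u_i, _) left by the first
    one, which gives the scalar F(u_i, w_i), or a further factor F; in the latter
    case sum_ext_ext recombines the two covectors into 2F. *)
Lemma contract_ext2_pow (I : finType) (u w : I -> V) m :
  (forall x z, \sum_i F (u i) x * F (w i) z = F x z) ->
  \sum_i iprod (w i) (iprod (u i) (ext2_pow F m.+1)) =
    (m.+1%:R * (\sum_i F (u i) (w i) - 2%:R * m%:R)) *: ext2_pow F m.
Proof.
move=> uwF.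
have E i : iprod (w i) (iprod (u i) (ext2_pow F m.+1)) =
   (m.+1%:R * F (u i) (w i)) *: ext2_pow F m
    - (m.+1%:R * m%:R) *: ext (F (u i)) (ext (F (w i)) (ext2_pow F m.-1)).
  rewrite iprod_ext2_pow linearZ /= iprod_ext iprod_ext2_pow extZ.
  by rewrite scalerBr !scalerA.
rewrite (eq_bigr _ (fun i _ => E i)) sumrB -scaler_suml -scaler_sumr.
rewrite (sum_ext_ext _ uwF FA).
have -> : (m.+1%:R * m%:R) *: (2%:R *: ext2 F (ext2_pow F m.-1)) =
          (m.+1%:R * m%:R * 2%:R) *: ext2_pow F m.
  by case: m {E} => [|m]; rewrite ?mulr0 ?mul0r ?scale0r // scalerA.
rewrite -scalerBl -mulr_sumr; congr (_ *: _); ring.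
Qed.

End Pow2.

End Powers.

(** * Alternating forms of top degree *)

Section Top.
Variables (R : realType) (V : vectType R).
Implicit Types (b : lform V) (a : V -> R) (A : V -> V) (x y : V) (s p q : seq V).

(** Polarization of alternation at x + y. *)
Lemma alt_form_swap b p q x y : alt_form b ->
  b (p ++ x :: y :: q) = - b (p ++ y :: x :: q).
Proof.
move=> [bM bA].
have bD u v r t : b (r ++ (u + v) :: t) = b (r ++ u :: t) + b (r ++ v :: t).
  by rewrite -[u in LHS]scale1r bM mul1r.
have bD2 u v w r t :
    b (r ++ w :: (u + v) :: t) = b (r ++ w :: u :: t) + b (r ++ w :: v :: t).
  by rewrite -cat_rcons bD !cat_rcons.
apply/eqP; rewrite -addr_eq0; have /eqP := bA p q (x + y).
by rewrite bD !bD2 !bA add0r addr0.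
Qed.

Lemma alt_form_front b p q r x : alt_form b ->
  b (p ++ q ++ x :: r) = (-1) ^+ size q * b (p ++ x :: q ++ r).
Proof.
move=> bF; elim: q p => [|y q IHq] p; first by rewrite mul1r.
rewrite /= -cat_rcons IHq cat_rcons alt_form_swap //= exprS; ring.
Qed.

Lemma alt_form_repeat b s : alt_form b -> ~~ uniq s -> b s = 0.
Proof.
move=> bF; have [_ bA] := bF; rewrite -[s in b s]cat0s.
elim: s [::] => [//|x s IHs] p /=; rewrite negb_and negbK => /orP[|sN].
  case/splitPr=> s1 s2; rewrite -cat_rcons alt_form_front // cat_rcons.
  by rewrite bA mulr0.
by rewrite -cat_rcons IHs.
Qed.

Lemma alt_form_perm b s t : alt_form b -> perm_eq s t -> b s = 0 -> b t = 0.
Proof.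
move=> bF; suff main p : perm_eq s t -> b (p ++ s) = 0 -> b (p ++ t) = 0.
  exact: (main [::]).
elim: t s p => [|x t IHt] s p; first by move=> /perm_nilP ->.
move=> st; have xs : x \in s by rewrite (perm_mem st) mem_head.
move: st; case/splitPr: xs => s1 s2; rewrite -cat1s perm_catCA perm_cons => st.
rewrite alt_form_front // => /eqP; rewrite mulf_eq0 signr_eq0 /= -!cat_rcons.
by move/eqP; apply: IHt.
Qed.

Lemma multilinear_sum b p q (I : finType) (c : I -> R) (u : I -> V) :
  multilinear b ->
  b (p ++ (\sum_i c i *: u i) :: q) = \sum_i c i * b (p ++ u i :: q).
Proof.
move=> bM; apply: (big_rec2 (fun x r => b (p ++ x :: q) = r)).
  exact: multilinear0.
by move=> i x r _ <-; rewrite bM.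
Qed.

Lemma multilinearN b p q x : multilinear b -> b (p ++ - x :: q) = - b (p ++ x :: q).
Proof.
move=> bM; have := multilinear_sum p q (fun=> -1) (fun _ : 'I_1 => x) bM.
by rewrite !big_ord1 scaleN1r mulN1r.
Qed.

Section Basis.
Variables (N : nat) (e : N.-tuple V).
Hypothesis eB : basis_of {:V} e.

Lemma multilinear_basis b k : multilinear b ->
  (forall q, all (mem e) q -> size q = k -> b q = 0) ->
  forall s, size s = k -> b s = 0.
Proof.
move=> bM b0.
(* The entries of the prefix p are expanded in the basis one at a time. *)
have main q p : all (mem e) q -> size (p ++ q) = k -> b (p ++ q) = 0.
  elim/last_ind: p q => [|p x IHp] q qe sq; first exact: b0.
  rewrite cat_rcons (coord_basis eB (memvf x)) multilinear_sum //.
  rewrite big1 // => i _; rewrite IHp ?mulr0 //= ?qe ?mem_nth ?size_tuple //.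
  by move: sq; rewrite !size_cat size_rcons addnS.
by move=> s sk; rewrite -[s]cats0 main ?cats0.
Qed.

Lemma alt_form_top0 b s : alt_form b -> b e = 0 -> size s = N -> b s = 0.
Proof.
move=> bF be0; apply: multilinear_basis; first by case: bF.
move=> q qe sq; have [uq|/(alt_form_repeat bF)//] := boolP (uniq q).
apply: alt_form_perm be0 => //; rewrite perm_sym uniq_perm //.
  by rewrite free_uniq ?(basis_free eB).
have [|_ eq] := uniq_min_size uq (allP qe); last by move=> y; rewrite eq.
by rewrite size_tuple -sq.
Qed.

Lemma alt_form_above b s : alt_form b -> (N < size s)%N -> b s = 0.
Proof.
move=> bF sN; apply: (@multilinear_basis _ (size s)) => //; first by case: bF.
move=> q qe sq; apply: alt_form_repeat => //; apply/negP=> uq.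
by have := uniq_leq_size uq (allP qe); rewrite size_tuple leqNgt sq sN.
Qed.

(** Both sides are alternating of top degree, so that it suffices to compare them on
    the basis e itself.  There the k-th term of the left hand side retains only the
    k-th coordinate of A e_k. *)
Lemma endo_act_top b A s : linear A -> alt_form b -> size s = N ->
  endo_act A b s = (\sum_i coord e i (A e`_i)) * b s.
Proof.
move=> AL bF sN; set t : R := \sum_i _.
have [[bM bA] [dM dA]] := (bF, endo_act_alt_form AL bF).
suff : (endo_act A b - t *: b) s = 0.
  by rewrite !lformE => /eqP; rewrite subr_eq0 => /eqP.
apply: alt_form_top0 => // {s sN}.
  split=> p q => [c x y | x]; rewrite !lformE ?dM ?bM ?dA ?bA; ring.
rewrite !lformE; apply/eqP; rewrite subr_eq0; apply/eqP.
(* The prefix p of e has been consumed by the recursion, which leaves the diagonal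
   coefficients with indices at least size p. *)
have main q p : p ++ q = e ->
  endo_act A (fun r => b (p ++ r)) q =
   (\sum_(i < N | (size p <= i)%N) coord e i (A e`_i)) * b (p ++ q).
  elim: q p => [|x q IHq] p pqe.
    rewrite big_pred0 ?mul0r // => i; apply/negbTE; rewrite -ltnNge.
    by rewrite -[p]cats0 pqe size_tuple ltn_ord.
  have pN : (size p < N)%N.
    by rewrite -(size_tuple e) -pqe size_cat /= addnS ltnS leq_addr.
  pose k := Ordinal pN.
  have ek : e`_k = x by rewrite -pqe nth_cat ltnn subnn.
  rewrite /= (_ : iprod x _ = fun r => b (rcons p x ++ r)); last first.
    by apply/funext => r; rewrite cat_rcons.
  rewrite IHq cat_rcons // size_rcons [in RHS](bigD1 k) //= mulrDl; congr (_ + _).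
    (* Replacing x by any other basis vector creates a repetition. *)
    rewrite {1}(coord_basis eB (memvf (A x))) multilinear_sum // (bigD1 k) //= ek.
    rewrite big1 ?addr0 // => i ik; rewrite alt_form_repeat ?mulr0 //.
    rewrite -cat1s uniq_catCA /= negb_and negbK.
    have : e`_i \in p ++ x :: q by rewrite pqe mem_nth ?size_tuple.
    rewrite !mem_cat inE -ek nth_uniq ?size_tuple ?(free_uniq (basis_free eB)) //.
    by rewrite -[(i == k :> nat)]/(i == k) (negbTE ik) => ->.
  congr (_ * _); apply: eq_bigl => i.
  by rewrite ltn_neqAle andbC eq_sym.
by rewrite -[endo_act A b]/(endo_act A (fun r => b ([::] ++ r))) main.
Qed.

End Basis.
End Top.

(** * The differential of a power on a unimodular Lie algebra *)

Section Unimodular.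
Variables (R : realType) (V : vectType R).
Implicit Types (b : lform V) (a : V -> R) (A : V -> V) (x y : V) (s p q : seq V).
Variables (N : nat) (e : N.-tuple V) (br : V -> V -> V).
Hypothesis eB : basis_of {:V} e.
Hypothesis brr : forall x, linear (br x).
Hypothesis brl : forall x, linear (br^~ x).
Hypothesis br0 : forall x, br x x = 0.
(* Unimodularity: the trace of br x, computed in the basis e, vanishes. *)
Hypothesis brU : forall x, \sum_(i < N) coord e i (br x e`_i) = 0.

(** Cartan's formula applied twice, to x and then to y, expresses the left hand side
    through d b, L_x b and L_y b evaluated on lists of length above N, N and N,
    where all three vanish; b (br y x :: s) is the term of L_y b in which br y acts
    on x. *)
Lemma CE_list_iprod2_top b x y s : alt_form b -> (size s).+1 = N ->
  CE_list br (iprod y (iprod x b)) s = b (br y x :: s).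
Proof.
move=> bF sN.
have /= xyN : size (y :: s) = N by [].
have dx : endo_act (br x) b (y :: s) = 0.
  by rewrite (endo_act_top eB) // brU mul0r.
have : endo_act (br y) b (x :: s) = 0.
  by rewrite (endo_act_top eB) // brU mul0r.
have : CE_list br b [:: x, y & s] = 0.
  by rewrite (alt_form_above eB) //=; [exact: CE_list_alt_form | rewrite sN].
rewrite -[CE_list br b _]/(- endo_act (br x) b (y :: s)
  - (- endo_act (br y) (iprod x b) s - CE_list br (iprod y (iprod x b)) s)).
rewrite dx /= => /eqP; rewrite oppr0 sub0r oppr_eq0 subr_eq0 => /eqP <-.
by move/eqP; rewrite addrC addr_eq0 => /eqP ->; rewrite opprK.
Qed.

End Unimodular.

(** The basis f serves to compute traces and the family e to contract forms; they
    are independent of each other.  Of the metric, only the relations between F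
    and J that are used below are retained. *)
Section Balanced.
Variables (R : realType) (V : vectType R).
Variables (N n : nat) (f : N.-tuple V) (e : (n.*2).-tuple V).
Implicit Types (b : lform V) (a : V -> R) (A : V -> V) (x y : V) (s p q : seq V).
Variable br : V -> V -> V.
Hypothesis fB : basis_of {:V} f.
Hypothesis Nn : N = n.*2.
Hypothesis brr : forall x, linear (br x).
Hypothesis brl : forall x, linear (br^~ x).
Hypothesis br0 : forall x, br x x = 0.
Hypothesis brU : forall x, \sum_(i < N) coord f i (br x f`_i) = 0.
Variables (J : V -> V) (F : V -> V -> R).
Hypothesis FL : forall c x y z, F (c *: x + y) z = c * F x z + F y z.
Hypothesis FA : forall x y, F x y = - F y x.
Hypothesis FJ : forall i : 'I_(n.*2), F (J e`_i) e`_i = 1.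
Hypothesis FJF : forall x z, \sum_(i < n.*2) F (J e`_i) x * F e`_i z = F x z.
Hypothesis Fnondeg : forall x, (forall y, F x y = 0) -> x = 0.

Lemma contract_ext2_powJ m :
  \sum_(i < n.*2) iprod e`_i (iprod (J e`_i) (ext2_pow F m.+1)) =
    (m.+1%:R * 2%:R * (n%:R - m%:R)) *: ext2_pow F m.
Proof.
rewrite (contract_ext2_pow FA _ FJF); congr (_ *: _).
rewrite (eq_bigr _ (fun i _ => FJ i)) sumr_const card_ord -muln2 natrM; ring.
Qed.

(** Contracting iota_x w_(m+1) = 0 with contract_ext2_powJ yields iota_x w_m = 0,
    since the factor n - m is nonzero in the range considered.  At the end of the
    descent this is F x = 0. *)
Lemma ext2_pow_nondeg x m : (m < n)%N ->
  (forall s, size s = m.*2.+1 -> ext2_pow F m.+1 (x :: s) = 0) -> x = 0.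
Proof.
elim: m => [|m IHm] mn x0.
  apply: Fnondeg => y; have := x0 [:: y] erefl.
  by rewrite /= /unit_form /= mulr1 subr0 !addr0.
apply: IHm => [|s sm]; first exact: ltnW.
have cN0 : m.+2%:R * 2%:R * (n%:R - m.+1%:R) != 0 :> R.
  by rewrite !mulf_neq0 ?pnatr_eq0 // subr_eq0 eqr_nat gtn_eqF.
apply/eqP; rewrite -(mulrI_eq0 _ (mulfI cN0)) -lform_scaleE -contract_ext2_powJ.
rewrite lform_sumE big1 // => i _.
rewrite [LHS](_ : _ = ext2_pow F m.+2 ([::] ++ [:: J e`_i; e`_i] ++ x :: s)) //.
rewrite alt_form_front; last exact: ext2_pow_alt_form.
by rewrite [ext2_pow F m.+2 _]x0 ?mulr0 //= sm.
Qed.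

Lemma CE_list_ext2_pow s : (0 < n)%N -> size s = (n.-1).*2.+1 ->
  (n%:R * 2%:R) * CE_list br (ext2_pow F n.-1) s =
    - ext2_pow F n ((\sum_(i < n.*2) br (J e`_i) e`_i) :: s).
Proof.
move=> n0 sm; have := contract_ext2_powJ n.-1; rewrite prednK // => E.
have {}E :
    CE_list br (\sum_(i < n.*2) iprod e`_i (iprod (J e`_i) (ext2_pow F n))) s =
      n%:R * 2%:R * CE_list br (ext2_pow F n.-1) s.
  rewrite E linearZ /= [LHS]/(_ * _); congr (_ * _).
  rewrite -natrB ?leq_pred // -subn1 subKn // mulr1n; exact: mulr1.
have pF := ext2_pow_alt_form FL FA n.
have sN : (size s).+1 = N by rewrite Nn sm -doubleS prednK.
have brA x y : br x y = - br y x.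
  apply/eqP; rewrite -addr_eq0; have := br0 (x + y).
  have brD u v w : br u (v + w) = br u v + br u w.
    by rewrite -[v in LHS]scale1r brr scale1r.
  have brDl u v w : br (u + v) w = br u w + br v w.
    by rewrite -[u in LHS]scale1r brl scale1r.
  by rewrite brD !brDl !br0 add0r addr0 addrC => ->.
rewrite -E linear_sum lform_sumE /=.
rewrite [in RHS](eq_bigr (fun i : 'I_(n.*2) => 1 *: br (J e`_i) e`_i)); last first.
  by move=> i _; rewrite scale1r.
rewrite [ext2_pow F n _](multilinear_sum [::]); last by case: pF.
rewrite -sumrN; apply: eq_bigr => i _.
rewrite (CE_list_iprod2_top fB) // brA mul1r.
by apply: (multilinearN [::]); case: pF.
Qed.

Lemma CE_list_ext2_pow_eq0 :
  (forall s, size s = (n.-1).*2.+1 -> CE_list br (ext2_pow F n.-1) s = 0) <->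
  \sum_(i < n.*2) br (J e`_i) e`_i = 0.
Proof.
case: (posnP n) => [n0|n0].
  split=> [_|_ s].
    by rewrite big1 // => -[i iN]; exfalso; rewrite n0 in iN.
  by rewrite n0; case: s => [|x []] //= _; rewrite oppr0 addr0.
split=> [CE0|X0 s sm].
  apply: (@ext2_pow_nondeg _ n.-1); rewrite ?ltn_predL ?prednK // => s sm.
  by apply/eqP; rewrite -oppr_eq0 -CE_list_ext2_pow // CE0 // mulr0.
have := CE_list_ext2_pow n0 sm; rewrite X0.
have [pM _] := ext2_pow_alt_form FL FA n.
have -> : ext2_pow F n (0 :: s) = 0 by apply: (multilinear0 [::]).
move=> /eqP; rewrite oppr0 mulf_eq0 mulf_eq0 !pnatr_eq0 eqn0Ngt n0 /=.
by move/eqP.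
Qed.

End Balanced.

(** * Comparison with cochains *)

Section Bridge.
Variables (R : realType) (V : vectType R).
Implicit Types (b : lform V) (a : V -> R) (A : V -> V) (x y : V) (s p q : seq V).

Definition lst k (v : 'I_k -> V) : seq V := [seq v i | i <- enum 'I_k].

Lemma lst_cons k (v : 'I_k.+1 -> V) : lst v = v ord0 :: lst (v \o lift ord0).
Proof. by rewrite /lst enum_ordSl /= -map_comp. Qed.

Lemma lst0 (v : 'I_0 -> V) : lst v = [::].
Proof. by rewrite /lst enum_ord0. Qed.

Lemma eq_lst k (v w : 'I_k -> V) : v =1 w -> lst v = lst w.
Proof. by move=> vw; apply: eq_map. Qed.

Lemma size_lst k (v : 'I_k -> V) : size (lst v) = k.
Proof. by rewrite size_map size_enum_ord. Qed.

Lemma lst_nth s : lst (fun i : 'I_(size s) => s`_i) = s.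
Proof.
elim: s => [|x s IHs]; first exact: lst0.
by rewrite lst_cons -[in RHS]IHs.
Qed.

Lemma lst_lift k (v : 'I_k.+2 -> V) (i : 'I_k.+1) :
  lst (v \o lift (lift ord0 i)) = v ord0 :: lst ((v \o lift ord0) \o lift i).
Proof.
rewrite lst_cons; congr (v _ :: _); first exact: val_inj.
by apply: eq_lst => j /=; congr (v _); apply: val_inj; apply: bumpS.
Qed.

Lemma ext_lst a b k (v : 'I_k.+1 -> V) :
  ext a b (lst v) = \sum_(i < k.+1) (-1) ^+ i * a (v i) * b (lst (v \o lift i)).
Proof.
elim: k b v => [|k IHk] b v; rewrite lst_cons big_ord_recl /= mul1r.
  by rewrite big_ord0 lst0 /= subr0 addr0.
rewrite IHk -sumrN; congr (_ + _); apply: eq_bigr => i _.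
by rewrite lst_lift exprS !mulN1r !mulNr.
Qed.

Lemma endo_act_lst A b k (v : 'I_k.+1 -> V) : alternating b -> multilinear b ->
  endo_act A b (lst v) =
  \sum_(i < k.+1) (-1) ^+ i * b (A (v i) :: lst (v \o lift i)).
Proof.
elim: k b v => [|k IHk] b v bA bM; rewrite lst_cons big_ord_recl /= mul1r.
  by rewrite big_ord0 lst0 /= addr0.
rewrite IHk; [|exact: iprod_alternating|exact: iprod_multilinear].
congr (_ + _); apply: eq_bigr => i _.
rewrite lst_lift exprS mulN1r mulNr -mulrN; congr (_ * _).
exact: (@alt_form_swap _ _ b [::]).
Qed.

(** The left hand side counts each ordered pair of entries, and F /\ b each unordered
    one, which explains the factor 2. *)
Lemma ext2_lst F b k (v : 'I_k.+1 -> V) : (forall x y, F x y = - F y x) ->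
  \sum_(i < k.+1) (-1) ^+ i * ext (F (v i)) b (lst (v \o lift i)) =
    2%:R * ext2 F b (lst v).
Proof.
move=> FA.
elim: k b v => [|k IHk] b v; rewrite [in RHS]lst_cons big_ord_recl /= mul1r.
  by rewrite big_ord0 lst0 /= !addr0 mulr0.
under eq_bigr => i _ do rewrite lst_lift exprS /= mulN1r mulNr -mulrN opprB mulrDr.
rewrite big_split /= -[in X in _ + (X + _)]/(iprod _ _).
rewrite (IHk (iprod (v ord0) b)) ext_lst mulrDr [RHS]addrC addrCA; congr (_ + _).
rewrite mulr_natl mulr2n; congr (_ + _); apply: eq_bigr => i _.
by rewrite FA; ring.
Qed.

Lemma CE_list_lst br b k (v : 'I_k.+1 -> V) : alternating b -> multilinear b ->
  CE_list br b (lst v) =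
  \sum_(i < k.+1) \sum_(j < k | (i <= j)%N) (-1) ^+ (i + j).+1 *
     b (br (v i) (v (lift i j)) :: lst (v \o lift i \o lift j)).
Proof.
elim: k b v => [|k IHk] b v bA bM; rewrite lst_cons big_ord_recl /=.
  by rewrite !big_ord0 lst0 /= oppr0.
rewrite IHk; [|exact: iprod_alternating|exact: iprod_multilinear].
rewrite endo_act_lst // -!sumrN; congr (_ + _); apply: eq_bigr => i _.
  by rewrite exprS mulN1r mulNr.
rewrite -sumrN big_mkcond [RHS]big_mkcond big_ord_recl /= add0r; apply: eq_bigr => j _.
rewrite [(bump _ _ <= bump _ _)%N]leq_bump2; case: ifP => // ij.
rewrite /bump /= !add1n addSn addnS !exprS !mulN1r !opprK -mulrN; congr (_ * _).
case: k v i j ij {IHk} => [|k] v i j ij; first by case: j ij.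
rewrite [X in b (_ :: X)]lst_cons -(@alt_form_swap _ _ b [::]) //.
rewrite /=; congr (b [:: br _ (v _), v _ & _]).
- by apply: val_inj; rewrite /= bumpS.
- exact: val_inj.
by apply: eq_lst => l; congr (v _); apply: val_inj; rewrite /= !bumpS.
Qed.

(** In CE_list_lst the index of the second entry of a pair is counted after the
    removal of the first, j standing for lift i j; in the differential of cochains
    it is the original index. *)
Lemma CE_diff_lst (br : {bilinear V -> V -> V}) b k (a : cochain V k)
    (v : {ffun 'I_k.+1 -> V}) : alt_form b -> (forall w, a w = b (lst w)) ->
  CE_diff br a v = CE_list br b (lst v).
Proof.
move=> [bM bA] ab; rewrite CE_list_lst //; apply: eq_bigr => i _.
rewrite big_mkcond (bigD1_ord i) //= ltnn add0r [RHS]big_mkcond /=.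
apply: eq_bigr => j _.
have -> : (i < bump i j)%N = (i <= j)%N by rewrite /bump; lia.
case: ifP => // ij; have -> : bump i j = j.+1 by rewrite /bump ij.
rewrite addnS ab; congr (_ * _).
case: k a v ab i j ij => [|k] a v ab i j ij; first by case: j ij.
rewrite lst_cons ffunE /=; congr (b (_ :: _)); apply: eq_lst => m /=.
rewrite ffunE /=; congr (v _); apply: val_inj.
rewrite /= inordK /bump; have := ltn_ord m; lia.
Qed.

Lemma lst_front b k (v : 'I_k.+1 -> V) (i : 'I_k.+1) : alt_form b ->
  b (lst v) = (-1) ^+ i * b (v i :: lst (v \o lift i)).
Proof.
elim: k b v i => [|k IHk] b v i bF.
  by rewrite (ord1 i) mul1r lst_cons.
case: (unliftP ord0 i) => [j ->|->]; last by rewrite mul1r lst_cons.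
rewrite lst_cons lst_lift -[b _]/(iprod (v ord0) b _).
rewrite (IHk _ _ j); last exact: iprod_alt_form.
rewrite exprS mulN1r mulNr -mulrN; congr (_ * _).
exact: (@alt_form_swap _ _ b [::]).
Qed.

(** Antisymmetrization without the usual factor 1 / k!, so that it is the sum which
    occurs in the wedge product of cochains. *)
Definition antisymmetrize k b (v : 'I_k -> V) : R :=
  \sum_(s : 'S_k) (-1) ^+ s * b (lst (v \o s)).

(** A permutation of k + 1 elements is the choice of an image i of 0 and of a
    permutation of the k remaining ones. *)
Lemma antisymmetrize_rec k b (v : 'I_k.+1 -> V) :
  antisymmetrize b v =
  \sum_(i < k.+1) (-1) ^+ i * antisymmetrize (iprod (v i) b) (v \o lift i).
Proof.
rewrite /antisymmetrize; under [RHS]eq_bigr => i _ do rewrite big_distrr /=.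
pose f (u : 'I_k.+1 * 'S_k) := lift_perm ord0 u.1 u.2.
have f_inj : injective f.
  move=> [i s] [j t] /permP/= st.
  have ij : i = j by have := st ord0; rewrite !lift_perm_id.
  subst j; congr pair; apply/permP => l.
  by have := st (lift ord0 l); rewrite !lift_perm_lift => /lift_inj.
have f_bij : bijective f.
  by apply: inj_card_bij => //; rewrite card_prod card_ord !card_Sn.
rewrite (reindex f) /=; last exact: onW_bij.
rewrite pair_bigA /=; apply: eq_bigr => -[i s] _ /=.
rewrite /f /= odd_lift_perm /= signr_addb signr_odd mulrA.
rewrite lst_cons /= lift_perm_id; congr (_ * b (_ :: _)).
by apply: eq_lst => l /=; rewrite lift_perm_lift.
Qed.

Lemma antisymmetrize_alt k b (v : 'I_k -> V) : alt_form b ->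
  antisymmetrize b v = k`!%:R * b (lst v).
Proof.
elim: k b v => [|k IHk] b v bF.
  rewrite /antisymmetrize (big_pred1 1%g) ?odd_perm1 ?mul1r; last first.
    by move=> s; apply/esym/eqP/permP => -[].
  by rewrite !lst0.
rewrite antisymmetrize_rec.
have E (i : 'I_k.+1) :
    (-1) ^+ i * antisymmetrize (iprod (v i) b) (v \o lift i) = k`!%:R * b (lst v).
  rewrite IHk; last exact: iprod_alt_form.
  by rewrite mulrCA [b (lst v)](lst_front _ i).
rewrite (eq_bigr _ (fun i _ => E i)) sumr_const card_ord factS natrM -mulrA.
by rewrite [RHS]mulr_natl.
Qed.

(** The wedge product of cochains is the antisymmetrization of the tensor product
    up to a factor.  One step of antisymmetrize_rec selects the entry to which the
    covector is applied; the form b, being alternating already, is then reproduced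
    k! times. *)
Lemma wedge1_lst a b k (u : cochain V 1) (c : cochain V k)
    (v : {ffun 'I_(1 + k) -> V}) :
  alt_form b -> (forall w, u w = a (w ord0)) -> (forall w, c w = b (lst w)) ->
  wedge u c v = ext a b (lst v).
Proof.
move=> bF ua cb; rewrite /wedge.
pose G : lform V := fun s => if s is x :: t then a x * b t else 0.
have -> : \sum_(s : 'S_(1 + k)) (-1) ^+ s *
    (u [ffun i => v (s (lshift k i))] * c [ffun j => v (s (rshift 1 j))]) =
   antisymmetrize G v.
  apply: eq_bigr => s _; congr (_ * _); rewrite ua cb !ffunE.
  rewrite lst_cons /=; congr (a (v (s _)) * b _); first exact: val_inj.
  by apply: eq_lst => j; rewrite ffunE /=; congr (v (s _)); apply: val_inj.
rewrite antisymmetrize_rec ext_lst.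
have -> : \sum_(i < k.+1) (-1) ^+ i * antisymmetrize (iprod (v i) G) (v \o lift i) =
   k`!%:R * \sum_(i < k.+1) (-1) ^+ i * a (v i) * b (lst (v \o lift i)).
  rewrite mulr_sumr; apply: eq_bigr => i _.
  rewrite [iprod _ G](_ : _ = a (v i) *: b) // antisymmetrize_alt; last first.
    by case: bF => bM bA; split=> p q *; rewrite !lform_scaleE ?bM ?bA; ring.
  rewrite lform_scaleE; ring.
by rewrite mul1n mulKf // pnatr_eq0 -lt0n fact_gt0.
Qed.

(** As for wedge1_lst, with two steps of antisymmetrize_rec for the arguments of F. *)
Lemma wedge2_lst F b k (a : cochain V 2) (c : cochain V k)
    (v : {ffun 'I_(2 + k) -> V}) :
  (forall x y, F x y = - F y x) -> alt_form b ->
  (forall w, a w = F (w ord0) (w ord_max)) -> (forall w, c w = b (lst w)) ->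
  wedge a c v = ext2 F b (lst v).
Proof.
move=> FA bF aF cb; rewrite /wedge.
pose G : lform V := fun s => if s is x :: y :: t then F x y * b t else 0.
have -> : \sum_(s : 'S_(2 + k)) (-1) ^+ s *
    (a [ffun i => v (s (lshift k i))] * c [ffun j => v (s (rshift 2 j))]) =
   antisymmetrize G v.
  apply: eq_bigr => s _; congr (_ * _); rewrite aF cb !ffunE.
  rewrite lst_cons [lst (_ \o lift ord0)]lst_cons /=.
  congr (F (v (s _)) (v (s _)) * b _); try exact: val_inj.
  by apply: eq_lst => j; rewrite ffunE /=; congr (v (s _)); apply: val_inj.
rewrite antisymmetrize_rec.
have E (i : 'I_k.+2) : (-1) ^+ i * antisymmetrize (iprod (v i) G) (v \o lift i) =
    k`!%:R * ((-1) ^+ i * ext (F (v i)) b (lst (v \o lift i))).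
  rewrite mulrCA; congr (_ * _); rewrite antisymmetrize_rec ext_lst mulr_sumr.
  apply: eq_bigr => j _.
  rewrite [iprod _ (iprod _ _)](_ : _ = F (v i) ((v \o lift i) j) *: b) //.
  rewrite antisymmetrize_alt; last first.
    by case: bF => bM bA; split=> p q *; rewrite !lform_scaleE ?bM ?bA; ring.
  rewrite lform_scaleE; ring.
rewrite (eq_bigr _ (fun i _ => E i)) -mulr_sumr ext2_lst //.
rewrite [k`!%:R * _]mulrA -natrM mulnC mulrA mulVf ?mul1r //.
by rewrite pnatr_eq0 -lt0n muln_gt0 !fact_gt0.
Qed.

Lemma wedge_exp_lst F m (a : cochain V 2) (v : {ffun 'I_(m * 2) -> V}) :
  (forall c x y z, F (c *: x + y) z = c * F x z + F y z) ->
  (forall x y, F x y = - F y x) ->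
  (forall w, a w = F (w ord0) (w ord_max)) ->
  @wedge_exp R V 2 a m v = ext2_pow F m (lst v).
Proof.
move=> FL FA aF; elim: m v => [|m IHm] v; first by rewrite /lst enum_ord0.
by apply: wedge2_lst => //; apply: ext2_pow_alt_form.
Qed.

Lemma balanced_lst (br : {bilinear V -> V -> V}) F n (a : cochain V 2) :
  (forall c x y z, F (c *: x + y) z = c * F x z + F y z) ->
  (forall x y, F x y = - F y x) ->
  (forall w, a w = F (w ord0) (w ord_max)) ->
  balanced br n a <->
  (forall s, size s = (n.-1).*2.+1 -> CE_list br (ext2_pow F n.-1) s = 0).
Proof.
move=> FL FA aF.
have E (v : {ffun 'I_(n.-1 * 2).+1 -> V}) :
    CE_diff br (@wedge_exp R V 2 a n.-1) v = CE_list br (ext2_pow F n.-1) (lst v).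
  by apply: CE_diff_lst => [|w]; [apply: ext2_pow_alt_form | apply: wedge_exp_lst].
split=> [bal s sn | CE0 v]; last first.
  by rewrite E CE0 // size_lst muln2.
have {}sn : size s = (n.-1 * 2).+1 by rewrite muln2.
rewrite -(lst_nth s); move: (fun _ => _) => v; move: v; rewrite sn => v.
by rewrite -[lst v](@eq_lst _ (finfun v)) -?E ?bal // => i; rewrite ffunE.
Qed.

End Bridge.

(** * Inner products and orthonormal bases *)

Lemma dot_of_posdef (R : realType) (V : vectType R) (f : V -> V -> R) :
  (forall c x y z, f (c *: x + y) z = c * f x z + f y z) ->
  (forall x y, f x y = f y x) ->
  (forall x, x != 0 -> 0 < f x x) ->
  exists g : {dot V for idfun}, forall x y, g x y = f x y.
Proof.
move=> fL fC fpos.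
have fB : bilinear_for ( *%R : R -> R -> R) (idfun \; *%R) f.
  by split=> [y | x] c u w /=; rewrite ?fL // !(fC x) fL.
have fH x y : f x y = (-1) ^+ false * idfun (f y x) by rewrite mul1r /= fC.
pose fb := bilinear_isBilinear.Build R V V R *%R (idfun \; *%R) f fB.
pose fh := isHermitianSesquilinear.Build R V false idfun f fH.
pose fd := isDotProduct.Build R V f fpos.
pose g : {dot V for idfun} := HB.pack f fb fh fd.
by exists g.
Qed.

Section InnerProduct.
Variables (R : realType) (V : vectType R) (g : {dot V for idfun}).

Lemma dotC x y : g x y = g y x.
Proof. by rewrite hermC mul1r. Qed.

Lemma dotPl c x y z : g (c *: x + y) z = c * g x z + g y z.
Proof. exact: linearPl. Qed.

Lemma dot_suml (I : Type) (r : seq I) (c : I -> R) (u : I -> V) z :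
  g (\sum_(i <- r) c i *: u i) z = \sum_(i <- r) c i * g (u i) z.
Proof.
rewrite linear_sumlz; apply: eq_bigr => i _.
exact: linearZl_LR.
Qed.

Lemma dot_eq0 x : g x x = 0 -> x = 0.
Proof.
by move=> gx; apply: contra_eq gx => /(neq0_dnorm_gt0 (s := g)) /lt0r_neq0.
Qed.

Lemma orthonormalE_pairwise s :
  orthonormal g s =
  all (fun x => g x x == 1) s && pairwise (fun x y => g x y == 0) s.
Proof.
rewrite /orthonormal; congr (_ && _).
by elim: s => [|x s IHs] //=; rewrite IHs andbT.
Qed.

Lemma orthonormal_tupleP N (e : N.-tuple V) :
  reflect (forall i j : 'I_N, g e`_i e`_j = (i == j)%:R) (orthonormal g e).
Proof.
rewrite orthonormalE_pairwise; apply: (iffP andP) => [[/allP e1 e0] i j|ge].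
  case: (ltngtP i j) => ij.
  - rewrite -(inj_eq val_inj) ltn_eqF //; apply/eqP.
    by apply: (pairwiseP 0 e0); rewrite ?inE ?size_tuple.
  - rewrite dotC -(inj_eq val_inj) gtn_eqF //; apply/eqP.
    by apply: (pairwiseP 0 e0); rewrite ?inE ?size_tuple.
  - rewrite (val_inj ij) eqxx; apply/eqP/e1.
    by rewrite mem_nth ?size_tuple.
split.
  apply/(all_nthP 0) => i; rewrite size_tuple => iN.
  by have := ge (Ordinal iN) (Ordinal iN); rewrite eqxx /= => ->.
apply/(pairwiseP 0) => i j; rewrite !inE size_tuple => iN jN ij.
have := ge (Ordinal iN) (Ordinal jN).
by rewrite -(inj_eq val_inj) /= ltn_eqF // => ->.
Qed.

Lemma orthonormal_basis N (e : N.-tuple V) :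
  \dim {:V} = N -> orthonormal g e -> basis_of {:V} e.
Proof.
move=> dimV /orthonormal_tupleP ge.
rewrite basisEfree subvf size_tuple dimV leqnn !andbT; apply/freeP => k k0 i.
have := congr1 (fun x => g x e`_i) k0; rewrite dot_suml (bigD1 i) //= big1.
  by rewrite ge eqxx mulr1 addr0 linear0l.
by move=> j ji; rewrite ge (negbTE ji) mulr0.
Qed.

Lemma parseval N (e : N.-tuple V) x y : basis_of {:V} e -> orthonormal g e ->
  \sum_(i < N) g e`_i x * g e`_i y = g x y.
Proof.
move=> eB /orthonormal_tupleP ge.
rewrite [in RHS](coord_basis eB (memvf x)) dot_suml; apply: eq_bigr => i _.
congr (_ * _); rewrite dotC [in LHS](coord_basis eB (memvf x)) dot_suml.
rewrite (bigD1 i) //= big1 => [|j ji]; first by rewrite ge eqxx mulr1 addr0.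
by rewrite ge (negbTE ji) mulr0.
Qed.

(** Gram-Schmidt: a vector outside the span of an orthonormal family is corrected by
    its orthogonal projection, normalized, and added to the family. *)
Lemma exists_orthonormal_basis N : \dim {:V} = N ->
  exists e : N.-tuple V, basis_of {:V} e /\ orthonormal g e.
Proof.
move=> dimV.
suff [e eo] : exists e : N.-tuple V, orthonormal g e.
  by exists e; split=> //; apply: orthonormal_basis.
have: (N <= \dim {:V})%N by rewrite dimV.
elim: {dimV} N => [|N IHN] NV; first by exists [tuple].
have [e eo] := IHN (ltnW NV).
have /subvPn[v _ ve] : ~~ (fullv <= <<e>>)%VS.
  apply: contraL NV => /dimvS Ve; rewrite -leqNgt (leq_trans Ve) //.
  by rewrite (leq_trans (dim_span _)) ?size_tuple.
pose u := v - \sum_(i < N) g v e`_i *: e`_i.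
have u0 : u != 0.
  apply: contraNneq ve => /eqP; rewrite subr_eq0 => /eqP ->.
  by apply: memv_suml => i _; rewrite memvZ // memv_span // mem_nth ?size_tuple.
have ue (j : 'I_N) : g u e`_j = 0.
  have /orthonormal_tupleP ge := eo.
  rewrite linearBl /= dot_suml (bigD1 j) //= big1 => [|i ij].
    by rewrite ge eqxx mulr1 addr0 subrr.
  by rewrite ge (negbTE ij) mulr0.
have gu : 0 < g u u by apply: neq0_dnorm_gt0.
pose c := (Num.sqrt (g u u))^-1.
exists [tuple of c *: u :: e].
move: eo; rewrite !orthonormalE_pairwise /= => /andP[-> ->]; rewrite !andbT.
have gZl a x y : g (a *: x) y = a * g x y by exact: linearZl_LR.
apply/andP; split.
  rewrite gZl dotC gZl mulrA -expr2 exprVn sqr_sqrtr ?ltW // mulVf //.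
  by rewrite gt_eqF.
apply/(all_nthP 0) => i; rewrite size_tuple => iN.
by rewrite gZl (ue (Ordinal iN)) mulr0.
Qed.

End InnerProduct.

Lemma endo_traceE (R : realType) (V : vectType R) (br : {bilinear V -> V -> V}) x :
  endo_trace (ad br x) =
    \sum_i coord (vbasis {:V}) i (br x (vbasis {:V})`_i).
Proof.
apply: eq_bigr => i _.
rewrite !mxE /= /ad lfunE /= /passmx.vecof (bigD1 i) //= big1 => [|j ji].
  by rewrite mxE !eqxx scale1r addr0.
by rewrite mxE eqxx /= (negbTE ji) scale0r.
Qed.

(** * The balanced condition in an orthonormal basis *)

(** The properties of F(x, y) = g(x, Jy) required by CE_list_ext2_pow_eq0 hold because
    F(Jx, y) = g(x, y) by orthogonality of J; the decomposition of F is then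
    Parseval's identity, and nondegeneracy is F(x, Jx) = - g(x, x). *)
Lemma balanced_orthonormal (R : realType) (n : nat) (V : vectType R)
    (dimV : \dim {:V} = n.*2)
    (br : {bilinear V -> V -> V}) (lie_br : lie_bracket br)
    (unimod : unimodular br) (J : 'End(V)) (g : {dot V for idfun})
    (e : (n.*2).-tuple V) :
  hermitian_structure br J g -> basis_of {:V} e -> orthonormal g e ->
  balanced br n (fundamental_form J g) <-> \sum_(i < n.*2) br (J e`_i) e`_i = 0.
Proof.
move=> [[JJ _] gJ] eB eo; have /orthonormal_tupleP ge := eo.
pose F x y := g x (J y).
have FL c x y z : F (c *: x + y) z = c * F x z + F y z by exact: dotPl.
have FA x y : F x y = - F y x.
  by rewrite /F -gJ JJ linearNr dotC.
rewrite (balanced_lst br n FL FA) //.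
apply: (CE_list_ext2_pow_eq0 (vbasisP _) dimV) => //.
- by move=> x a y z; rewrite linearPr.
- by move=> x a y z; rewrite linearPl.
- by case: lie_br.
- by move=> x; rewrite -endo_traceE.
- by move=> i; rewrite /F gJ ge eqxx.
- move=> x z; rewrite /F -(parseval x (J z) eB eo).
  by apply: eq_bigr => i _; rewrite gJ.
move=> x /(_ (J x)); rewrite /F JJ linearNr => /eqP.
by rewrite oppr_eq0 => /eqP/dot_eq0.
Qed.

(** * The metric of an adapted basis *)

Section Adapted.
Variables (R : realType) (V : vectType R) (n : nat) (e : (n.*2).-tuple V).

Lemma sum_odd_even (W : nmodType) (f : 'I_(n.*2) -> W) :
  \sum_(i < n.*2) f i = \sum_(k < n) (f (odd_idx k) + f (even_idx k)).
Proof.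
pose h (u : 'I_n * bool) := if u.2 then even_idx u.1 else odd_idx u.1.
have h_inj : injective h.
  move=> [k []] [l []] /(congr1 val) /= kl; try by exfalso; lia.
    by congr pair; apply: val_inj => /=; lia.
  by congr pair; apply: val_inj => /=; lia.
have h_bij : bijective h.
  by apply: inj_card_bij => //; rewrite card_prod card_bool !card_ord muln2.
rewrite (reindex h) /=; last exact: onW_bij.
rewrite -(pair_bigA _ (fun k b => f (h (k, b)))) /=; apply: eq_bigr => k _.
by rewrite big_bool addrC.
Qed.

Lemma adapted_formE v :
  adapted_form e v = \sum_(k < n)
    (coord e (odd_idx k) (v ord0) * coord e (even_idx k) (v ord_max)
     - coord e (even_idx k) (v ord0) * coord e (odd_idx k) (v ord_max)).
Proof.
apply: eq_bigr => k _.
pose b := ext (coord e (even_idx k)) (@unit_form R V).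
rewrite (@wedge1_lst _ _ (coord e (odd_idx k)) b) /b //.
- rewrite lst_cons lst_cons lst0 /= /unit_form /=.
  rewrite (_ : lift ord0 ord0 = ord_max); last exact: val_inj.
  rewrite /iprod /=; ring.
- apply: (@ext_alt_form R V (coord e (even_idx k)) (@unit_form R V)).
    exact: linearP.
  exact: unit_form_alt_form.
by move=> w; rewrite lst_cons lst0 /= /unit_form /dual_covector /= subr0 mulr1.
Qed.

Variable J : 'End(V).
Hypothesis JJ : forall x, J (J x) = - x.
Hypothesis eJ : adapted_basis e J.

Lemma adapted_even (k : 'I_n) : J e`_(even_idx k) = e`_(odd_idx k).
Proof.
have [_ Jo] := eJ.
by apply: oppr_inj; rewrite -[RHS]JJ Jo linearN.
Qed.

Lemma adapted_coordJ x (k : 'I_n) :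
  coord e (odd_idx k) (J x) = coord e (even_idx k) x /\
  coord e (even_idx k) (J x) = - coord e (odd_idx k) x.
Proof.
have [eB Jo] := eJ; have eF := basis_free eB.
have Jx : J x = \sum_l (coord e (even_idx l) x *: e`_(odd_idx l)
                       - coord e (odd_idx l) x *: e`_(even_idx l)).
  rewrite {1}(coord_basis eB (memvf x)) linear_sum sum_odd_even /=.
  apply: eq_bigr => l _; rewrite !linearZ /= adapted_even Jo.
  by rewrite scalerN addrC.
have oo (i j : 'I_n) : (odd_idx i == odd_idx j) = (i == j).
  by rewrite -!(inj_eq val_inj) /= (inj_eq double_inj).
have ee (i j : 'I_n) : (even_idx i == even_idx j) = (i == j).
  by rewrite -!(inj_eq val_inj) /= eqSS (inj_eq double_inj).
have oe (i j : 'I_n) : (odd_idx i == even_idx j) = false.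
  by rewrite -(inj_eq val_inj) /=; lia.
have eo (i j : 'I_n) : (even_idx i == odd_idx j) = false.
  by rewrite eq_sym oe.
have coordB i (o w : 'I_n -> 'I_(n.*2)) (c d : 'I_n -> R) :
    coord e i (\sum_l (c l *: e`_(o l) - d l *: e`_(w l))) =
    \sum_l (c l * (i == o l)%:R - d l * (i == w l)%:R).
  rewrite linear_sum; apply: eq_bigr => l _.
  by rewrite linearB !linearZ /= !coord_free // ![_ == i]eq_sym.
rewrite Jx !(coordB _ (@odd_idx n) (@even_idx n)).
split; rewrite (bigD1 k) // big1 => [|l lk];
  by rewrite ?oo ?oe ?eo ?ee ?eqxx ?[k == l]eq_sym ?(negbTE lk) /=; ring.
Qed.

(** The inner product is the one that makes e orthonormal.  By adapted_coordJ, J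
    exchanges the two coordinates of each pair up to a sign, hence is orthogonal,
    and g(x, Jy) takes the form of the sum of the e^(2k-1) /\ e^(2k). *)
Lemma adapted_dot : exists g : {dot V for idfun},
  [/\ orthonormal g e, forall x y, g (J x) (J y) = g x y
    & fundamental_form J g =1 adapted_form e].
Proof.
have [eB _] := eJ; have eF := basis_free eB.
have [||x x0|g gE] := @dot_of_posdef R V
   (fun x y => \sum_(i < n.*2) coord e i x * coord e i y).
- move=> c x y z; rewrite mulr_sumr -big_split; apply: eq_bigr => i _ /=.
  by rewrite linearP /=; ring.
- by move=> x y; apply: eq_bigr => i _; rewrite mulrC.
- rewrite lt0r sumr_ge0 ?andbT => [|i _]; last by rewrite -expr2 sqr_ge0.
  apply: contra x0; rewrite psumr_eq0 => [/allP x0|i _]; last by rewrite -expr2 sqr_ge0.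
  apply/eqP; rewrite (coord_basis eB (memvf x)) big1 // => i _.
  have := x0 i (mem_index_enum _); rewrite /= mulf_eq0 orbb => /eqP ->.
  by rewrite scale0r.
have gJE x y : g x (J y) = \sum_(k < n)
    (coord e (odd_idx k) x * coord e (even_idx k) y
     - coord e (even_idx k) x * coord e (odd_idx k) y).
  rewrite gE sum_odd_even; apply: eq_bigr => k _.
  by have [-> ->] := adapted_coordJ y k; rewrite mulrN.
exists g; split.
- apply/orthonormal_tupleP => i j; rewrite gE (bigD1 i) //= big1 => [|l li].
    by rewrite !coord_free // eqxx mul1r eq_sym addr0.
  by rewrite !coord_free // [i == l]eq_sym (negbTE li) mul0r.
- move=> x y; rewrite gJE gE sum_odd_even; apply: eq_bigr => k _.
  have [-> ->] := adapted_coordJ x k; ring.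
by move=> v; rewrite adapted_formE /fundamental_form gJE.
Qed.

End Adapted.

Theorem lemma2p1 (R : realType) (n : nat) (V : vectType R)
    (dimV : \dim {:V} = n.*2)
    (br : {bilinear V -> V -> V}) (lie_br : lie_bracket br)
    (unimod : unimodular br) :
  (forall (J : 'End(V)) (g : {dot V for idfun}),
     hermitian_structure br J g ->
     (balanced br n (fundamental_form J g) <->
      exists e : (n.*2).-tuple V,
        [/\ basis_of {:V} e, orthonormal g e
          & \sum_(i < n.*2) br (J e`_i) e`_i = 0]))
  /\
  (forall (J : 'End(V)) (e : (n.*2).-tuple V),
     complex_structure br J ->
     adapted_basis e J ->
     \sum_(i < n.*2) br (J e`_i) e`_i = 0 ->
     exists g : {dot V for idfun},
       [/\ hermitian_structure br J g,
           fundamental_form J g =1 adapted_form e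
         & balanced br n (adapted_form e)]).
Proof.
split=> [J g Jg | J e [JJ Jint] eJ e0].
  split=> [bal | [e [eB eo e0]]].
    have [e [eB eo]] := exists_orthonormal_basis g dimV.
    by exists e; split=> //; apply/(balanced_orthonormal dimV lie_br unimod Jg eB eo).
  exact/(balanced_orthonormal dimV lie_br unimod Jg eB eo).
have [g [eo gJ FE]] := adapted_dot JJ eJ.
have Jg : hermitian_structure br J g by [].
exists g; split=> //; rewrite -(funext FE).
by apply/(balanced_orthonormal dimV lie_br unimod Jg _ eo) => //; case: eJ.
Qed.
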